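(* Let $Y\subseteq\ell_\infty^n$ be a linear subspace of the complex $\ell_\infty^n$ space given as $Y=\ker f=\{z\in\mathbb{C}^n:\ \sum_{j=1}^nf_jz_j=0\}$, where a vector $f=(f_1,\dots,f_n)\in\mathbb{C}^n$ satisfies the conditions $\|f\|_1=\sum_{j=1}^n|f_j|=1$ and $0<|f_j|<\frac12$ for every $1\le j\le n$. Then the minimal projection from $\ell_\infty^n$ onto $Y$ is $2$-strongly unique, but it is not $\alpha$-strongly unique for any $\alpha<2$ (where $\alpha\ge1$).
   Context: The complex space $\ell_\infty^n$ is $\mathbb{C}^n$ with norm $\|x\|_\infty=\max_j|x_j|$. For a linear subspace $Y$ of a finite-dimensional normed space $X$, a projection $P:X\to Y$ is a linear map with $P(y)=y$ for all $y\in Y$; $\|P\|$ is the operator norm. The relative projection constant is $\lambda(Y,X)=\inf\|P\|$ over all linear projections $P:X\to Y$, and $P$ is a minimal projection if $\|P\|=\lambda(Y,X)$. For a real $\alpha\ge1$, a projection $P:X\to Y$ is an $\alpha$-strongly unique minimal projection if there is $r>0$ such that $\|Q\|^\alpha\ge\|P\|^\alpha+r\|Q-P\|^\alpha$ for every linear projection $Q:X\to Y$. *)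

(* Defs.v *)
From HB Require Import structures.
From mathcomp Require Import all_boot all_order all_algebra.
From mathcomp Require Import complex.
From mathcomp Require Import classical_sets reals exp.

Set Implicit Arguments.
Unset Strict Implicit.
Unset Printing Implicit Defensive.

Import Order.TTheory GRing.Theory Num.Theory.
Import ComplexField.Normc.

Local Open Scope ring_scope.
Local Open Scope complex_scope.
Local Open Scope classical_set_scope.

Section Projections.
Variables (R : realType) (V : vectType R[i]).
Variable nrm : V -> R.

Definition opnorm (T : 'End(V)) : R := sup [set nrm (T x) | x in [set x | nrm x <= 1]].

(* Projections onto Y are represented as endomorphisms of the whole space with
   values in Y, so that the difference of two of them has an operator norm. *)
Definition is_projection (Y : {vspace V}) (P : 'End(V)) : Prop :=
  (forall x, P x \in Y) /\ (forall y, y \in Y -> P y = y).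

Definition rel_proj_const (Y : {vspace V}) : R :=
  inf [set opnorm P | P in is_projection Y].

Definition is_minimal_projection (Y : {vspace V}) (P : 'End(V)) : Prop :=
  is_projection Y P /\ opnorm P = rel_proj_const Y.

Definition strongly_unique (alpha : R) (Y : {vspace V}) (P : 'End(V)) : Prop :=
  is_projection Y P /\
  exists2 r : R, 0 < r & forall Q, is_projection Y Q ->
    opnorm P `^ alpha + r * opnorm (Q - P) `^ alpha <= opnorm Q `^ alpha.

End Projections.

Section Linfty.
Variables (R : realType) (n : nat).

Definition linf_norm (x : 'cV[R[i]]_n) : R :=
  \big[Num.max/0]_(j < n) normc (x j 0).

Definition l1_norm (f : 'rV[R[i]]_n) : R := \sum_(j < n) normc (f 0 j).

Definition hyperplane (f : 'rV[R[i]]_n) : {vspace 'cV[R[i]]_n} :=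
  lker (linfun (mulmx f : 'cV[R[i]]_n -> 'cV[R[i]]_1)).

Lemma mem_hyperplane (f : 'rV[R[i]]_n) (z : 'cV[R[i]]_n) :
  (z \in hyperplane f) = (\sum_(j < n) f 0 j * z j 0 == 0).
Proof.
rewrite memv_ker lfunE /=; apply/eqP/eqP => [/matrixP /(_ 0 0)|H].
  by rewrite !mxE.
by apply/matrixP => i j; rewrite !ord1 !mxE.
Qed.

End Linfty.

(* Main.v *)
Require Import Defs.
From mathcomp Require Import all_boot all_order all_algebra.
From mathcomp Require Import complex ring lra.
From mathcomp Require Import classical_sets reals exp.

(* Every projection onto ker f is x |-> x - f(x) u with f(u) = 1. Writing
   w_i = f_i u_i and c_i = 1 / |f_i| - 1 > 1, its norm M is the maximum of the
   row sums |1 - w_i| + c_i |w_i|, to be minimised over \sum w_i = 1. The minimum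
   m = 1 + 1 / S, with S = \sum 1 / (c_i - 1), is attained at the positive real
   vector v_i = 1 / ((c_i - 1) S). Averaging the row bounds with the weights
   1 / (c_i - 1) bounds Re (w_i - v_i) and |w_i| - Re w_i by multiples of M - m;
   since (Im w_i)^2 = (|w_i| - Re w_i)(|w_i| + Re w_i), this gives
   |w_i - v_i|^2 <= K (M^2 - m^2). Conversely, moving v by s in imaginary
   directions increases the norm only by O(s^2), which excludes alpha < 2. *)

Import Order.TTheory GRing.Theory Num.Theory.
Import ComplexField.Normc.

Set Implicit Arguments.
Unset Strict Implicit.
Unset Printing Implicit Defensive.

Local Open Scope ring_scope.
Local Open Scope complex_scope.

(** * Modulus and phase of complex numbers *)

Lemma normc_ge0 (R : rcfType) (z : R[i]) : 0 <= normc z.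
Proof. by case: z => a b; apply: sqrtr_ge0. Qed.

Lemma normc_sqr (R : rcfType) (z : R[i]) :
  normc z ^+ 2 = complex.Re z ^+ 2 + complex.Im z ^+ 2.
Proof. by case: z => a b; rewrite /= sqr_sqrtr ?addr_ge0 ?sqr_ge0. Qed.

Lemma normc_real (R : rcfType) (a : R) : normc a%:C = `|a|.
Proof. by rewrite /= expr0n addr0 sqrtr_sqr. Qed.

Lemma Re_le_normc (R : rcfType) (z : R[i]) : complex.Re z <= normc z.
Proof.
apply: le_trans (ler_norm _) _; rewrite -sqrtr_sqr.
by case: z => a b /=; apply: ler_wsqrtr; rewrite lerDl sqr_ge0.
Qed.

Lemma normc_sum (R : rcfType) (I : finType) (F : I -> R[i]) :
  normc (\sum_i F i) <= \sum_i normc (F i).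
Proof.
elim/big_rec2: _ => [|i y x _ le_xy]; first by rewrite normc0.
by apply: le_trans (le_normcD _ _) _; rewrite lerD2l.
Qed.

(** Squaring the right side produces the cross term [2 * b ^+ 2], which covers the [b ^+ 2] under
    the root. This makes an imaginary displacement of a positive number a second-order effect on the
    modulus. *)
Lemma normc_le_quadratic (R : rcfType) (a b : R) :
  0 < a -> normc (a +i* b) <= a + b ^+ 2 / a.
Proof.
move=> a_gt0; have q_ge0 : 0 <= b ^+ 2 / a by rewrite divr_ge0 ?sqr_ge0 ?ltW.
rewrite /= -[leRHS]ger0_norm ?addr_ge0 ?(ltW a_gt0) // -sqrtr_sqr.
apply: ler_wsqrtr.
have -> : (a + b ^+ 2 / a) ^+ 2 = a ^+ 2 + 2 * b ^+ 2 + (b ^+ 2 / a) ^+ 2.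
  by field; rewrite gt_eqF.
have := sqr_ge0 b; have := sqr_ge0 (b ^+ 2 / a); lra.
Qed.

(** Since [0^-1 = 0], the phase of [0] is [0]; hence [normc_conj_phase] is only an inequality. *)
Definition conj_phase (R : rcfType) (z : R[i]) : R[i] := z^* / (normc z)%:C.

Lemma mul_conj_phase (R : rcfType) (z : R[i]) : z * conj_phase z = (normc z)%:C.
Proof.
have [->|z_neq0] := eqVneq z 0; first by rewrite mul0r normc0.
have nz_neq0 : normc z != 0 by apply: contraNneq z_neq0 => /eq0_normc ->.
rewrite /conj_phase mulrA; have -> : z * z^* = (normc z ^+ 2)%:C.
  by rewrite normc_sqr; case: z {z_neq0 nz_neq0} => a b; simpc;
     congr (_ +i* _); ring.
by rewrite -fmorphV -rmorphM expr2 mulfK.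
Qed.

Lemma normc_conj_phase (R : rcfType) (z : R[i]) : normc (conj_phase z) <= 1.
Proof.
have [->|z_neq0] := eqVneq z 0.
  by rewrite /conj_phase rmorph0 mul0r normc0 ler01.
have nz_neq0 : normc z != 0 by apply: contraNneq z_neq0 => /eq0_normc ->.
have /(congr1 (@normc R)) := mul_conj_phase z.
rewrite normcM normc_real ger0_norm ?normc_ge0 // => eq_n.
suff -> : normc (conj_phase z) = 1 by [].
by apply: (mulfI nz_neq0); rewrite eq_n mulr1.
Qed.

(** * The operator norm on the max-norm space as the largest absolute row sum *)

Section LinftyOpnorm.
Variables (R : realType) (n : nat).
Implicit Types (A : 'M[R[i]]_n) (x : 'cV[R[i]]_n) (T : 'End('cV[R[i]]_n)).

Lemma linf_norm_mulmx A (C : R) x : 0 <= C ->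
  (forall i, \sum_j normc (A i j) <= C) -> linf_norm x <= 1 ->
  linf_norm (A *m x) <= C.
Proof.
move=> C_ge0 row_le /bigmax_leP[_ x_le]; apply/bigmax_leP; split=> // i _.
rewrite mxE; apply: le_trans (normc_sum _) _; apply: le_trans (row_le i).
apply: ler_sum => j _; rewrite normcM -[leRHS]mulr1 ler_wpM2l ?normc_ge0 //.
exact: x_le.
Qed.

Lemma opnorm_le_row_sum T A (C : R) : (forall x, T x = A *m x) -> 0 <= C ->
  (forall i, \sum_j normc (A i j) <= C) -> opnorm (@linf_norm R n) T <= C.
Proof.
move=> TA C_ge0 row_le; apply: ge_sup.
  exists (linf_norm (T 0)); exists 0 => //=.
  by apply/bigmax_leP; split=> // j _; rewrite mxE normc0.
by move=> _ [x /= x_le1 <-]; rewrite TA linf_norm_mulmx.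
Qed.

Lemma row_sum_le_opnorm T A i : (forall x, T x = A *m x) ->
  \sum_j normc (A i j) <= opnorm (@linf_norm R n) T.
Proof.
move=> TA.
(* Multiplied by its conjugate phase, each entry of row [i] becomes its modulus, so coordinate [i]
   of [A *m x] is the whole row sum. *)
pose x : 'cV[R[i]]_n := \col_j conj_phase (A i j).
have x_le1 : linf_norm x <= 1.
  by apply/bigmax_leP; split=> // j _; rewrite mxE normc_conj_phase.
have Ax : normc ((A *m x) i 0) = \sum_j normc (A i j).
  have -> : (A *m x) i 0 = (\sum_j normc (A i j))%:C.
    by rewrite mxE rmorph_sum; apply: eq_bigr => j _; rewrite mxE mul_conj_phase.
  by rewrite normc_real ger0_norm // sumr_ge0 // => j _; rewrite normc_ge0.
apply: (@le_trans _ _ (linf_norm (T x))).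
  by rewrite TA -Ax; apply: (le_bigmax (0 : R) (fun j => normc ((A *m x) j 0))).
apply: ub_le_sup; last by exists x.
(* [ub_le_sup] requires a bounded set; the sum of all moduli is a crude bound for every row. *)
exists (\sum_i \sum_j normc (A i j)) => _ [y /= y_le1 <-].
rewrite TA linf_norm_mulmx // => [|k].
  by do 2![apply: sumr_ge0 => ? _]; rewrite normc_ge0.
rewrite [leRHS](bigD1 k) //= lerDl.
by do 2![apply: sumr_ge0 => ? _]; rewrite normc_ge0.
Qed.

End LinftyOpnorm.

(** * Comparison of powers for small displacements *)

(** The increment on the left has order [s ^ alpha], the one on the right order [s ^ 2]. Dividing by
    [s ^ alpha] gives [A <= B s ^ (2 - alpha)] with [A > 0], which fails for small [s]. *)
Lemma powR_no_quadratic_bound (R : realType) (m C k r alpha : R) :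
  1 <= m -> 0 <= C -> 0 < k -> 0 < r -> 1 <= alpha -> alpha < 2 ->
  ~ (forall s, 0 < s <= 1 ->
       m `^ alpha + r * (k * s) `^ alpha <= (m + C * s ^+ 2) `^ alpha).
Proof.
move=> m_ge1 C_ge0 k_gt0 r_gt0 a_ge1 a_lt2 H.
have m_gt0 : 0 < m by lra.
(* [B] comes from [(1 + C s^2)^alpha <= (1 + C s^2)^2 <= 1 + (2 C + C^2) s^2] for [s <= 1]. *)
pose A := r * k `^ alpha; pose B := m `^ alpha * (2 * C + C ^+ 2).
have A_gt0 : 0 < A by rewrite mulr_gt0 ?powR_gt0.
have B_ge0 : 0 <= B by rewrite mulr_ge0 ?powR_ge0 // addr_ge0 ?sqr_ge0 //; lra.
have key s : 0 < s <= 1 -> A <= B * s `^ (2 - alpha).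
  move=> /andP[s_gt0 s_le1].
  have s2_le1 : s ^+ 2 <= 1 by rewrite expr_le1 // ltW.
  have := sqr_ge0 s => s2_ge0.
  have Cs_ge0 : 0 <= C * s ^+ 2 by rewrite mulr_ge0.
  have ub : (m + C * s ^+ 2) `^ alpha <= m `^ alpha + B * s ^+ 2.
    (* As [1 <= m], enlarging [C s^2] to [m C s^2] lets [m] be factored out. *)
    apply: (@le_trans _ _ ((m * (1 + C * s ^+ 2)) `^ alpha)).
      apply: ge0_ler_powR; rewrite ?nnegrE ?addr_ge0 ?mulr_ge0 ?addr_ge0 //; try lra.
      rewrite mulrDr mulr1 lerD2l; nra.
    rewrite powRM ?addr_ge0 ?(ltW m_gt0) //.
    have -> : m `^ alpha + B * s ^+ 2
            = m `^ alpha * (1 + (2 * C + C ^+ 2) * s ^+ 2) by rewrite /B; ring.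
    rewrite ler_wpM2l ?powR_ge0 //.
    apply: (@le_trans _ _ ((1 + C * s ^+ 2) `^ 2)).
      by apply: ler_powR; rewrite ?lerDl // ltW.
    rewrite powR_mulrn ?addr_ge0 //.
    have : C ^+ 2 * s ^+ 2 * s ^+ 2 <= C ^+ 2 * s ^+ 2.
      by apply: ler_piMr => //; rewrite mulr_ge0 ?sqr_ge0.
    have -> : (1 + C * s ^+ 2) ^+ 2
            = 1 + 2 * C * s ^+ 2 + C ^+ 2 * s ^+ 2 * s ^+ 2 by ring.
    lra.
  have := H s; rewrite s_gt0 s_le1 => /(_ isT).
  rewrite powRM ?(ltW k_gt0) ?(ltW s_gt0) // => /le_trans/(_ ub).
  rewrite lerD2l mulrA -/A => le_AB.
  have s_pow : s ^+ 2 = s `^ (2 - alpha) * s `^ alpha.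
    by rewrite -powRD ?subrK ?powR_mulrn ?(ltW s_gt0) // (gt_eqF s_gt0) implybT.
  by move: le_AB; rewrite s_pow mulrA ler_pM2r // powR_gt0.
(* Taking [s] with [s ^ (2 - alpha) = q], [key] would give [A <= B * q < A]. *)
pose q := A / (2 * (A + B)).
have AB_gt0 : 0 < 2 * (A + B) by lra.
have q_gt0 : 0 < q by rewrite divr_gt0.
have q_le1 : q <= 1 by rewrite ler_pdivrMr //; lra.
have e_neq0 : 2 - alpha != 0 by rewrite gt_eqF; lra.
have := key (q `^ (2 - alpha)^-1).
rewrite powR_gt0 // -powRrM mulVf // powRr1 ?(ltW q_gt0) //.
have -> : q `^ (2 - alpha)^-1 <= 1.
  rewrite -[leRHS](powRr0 q); apply: ger_powR; rewrite ?q_gt0 //.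
  by rewrite invr_ge0; lra.
move=> /(_ isT); rewrite leNgt => /negP; apply.
rewrite /q mulrA ltr_pdivrMr //; nra.
Qed.

(** * The scalar minimisation problem for the row sums *)

Section RowBounds.
Variables (R : rcfType) (n : nat) (c : 'I_n -> R).
Hypothesis c_gt1 : forall i, 1 < c i.
Hypothesis n_gt0 : (0 < n)%N.

Definition weight_sum : R := \sum_i (c i - 1)^-1.

(** This choice equalises the rows: [1 + (c i - 1) v] takes the same value for all [i] exactly when
    [v] is proportional to [1 / (c i - 1)], and the sum is normalised to 1. *)
Definition opt_coord (i : 'I_n) : R := (c i - 1)^-1 / weight_sum.

(** For [c i = 1 / |f_i| - 1] this is the absolute sum of row [i] of a projection matrix with
    parameter [z]: diagonal entry, then the rest of the row. *)
Definition row_norm (i : 'I_n) (z : R[i]) : R := normc (1 - z) + c i * normc z.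

Lemma weight_gt0 i : 0 < (c i - 1)^-1.
Proof. by rewrite invr_gt0 subr_gt0. Qed.

Lemma weight_le_sum i : (c i - 1)^-1 <= weight_sum.
Proof.
by rewrite /weight_sum (bigD1 i) //= lerDl sumr_ge0 // => j _;
   rewrite ltW ?weight_gt0.
Qed.

Lemma weight_sum_gt0 : 0 < weight_sum.
Proof. exact: lt_le_trans (weight_gt0 (Ordinal n_gt0)) (weight_le_sum _). Qed.

Lemma sum_opt_coord : \sum_i opt_coord i = 1.
Proof. by rewrite -mulr_suml divff // gt_eqF ?weight_sum_gt0. Qed.

Lemma opt_coord_gt0 i : 0 < opt_coord i.
Proof. by rewrite divr_gt0 ?weight_gt0 ?weight_sum_gt0. Qed.

Lemma opt_coord_le1 i : opt_coord i <= 1.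
Proof. by rewrite ler_pdivrMr ?weight_sum_gt0 // mul1r weight_le_sum. Qed.

(** A second index takes a positive share of the total 1. Strictness makes [1 - opt_coord i] a
    positive denominator in [row_norm_opt_perturb]. *)
Lemma opt_coord_lt1 i j : j != i -> opt_coord i < 1.
Proof.
move=> ji; rewrite -sum_opt_coord (bigD1 i) //= ltrDl (bigD1 j) //=.
rewrite ltr_pwDl ?opt_coord_gt0 // sumr_ge0 // => k _.
exact/ltW/opt_coord_gt0.
Qed.

Lemma opt_row_eq i :
  1 - opt_coord i + c i * opt_coord i = 1 + weight_sum^-1.
Proof.
have := c_gt1 i; have := weight_sum_gt0; rewrite /opt_coord => S_gt0 c_gt.
by field; rewrite !gt_eqF // subr_gt0.
Qed.

Lemma row_norm_opt i : row_norm i (opt_coord i)%:C = 1 + weight_sum^-1.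
Proof.
rewrite /row_norm -(opt_row_eq i) -[1 in LHS](rmorph1 (real_complex R)) -rmorphB.
by rewrite !normc_real !ger0_norm ?subr_ge0 ?opt_coord_le1 // ltW ?opt_coord_gt0.
Qed.

(** Both [1 - z] and [z] keep a positive real part, so [normc_le_quadratic] applies to each of the
    two moduli. *)
Lemma row_norm_opt_perturb i e s : opt_coord i < 1 -> e ^+ 2 <= 1 ->
  row_norm i (opt_coord i +i* (e * s)) <=
    1 + weight_sum^-1 + ((1 - opt_coord i)^-1 + c i / opt_coord i) * s ^+ 2.
Proof.
move=> v_lt1 e_le1; have v_gt0 := opt_coord_gt0 i.
have w_gt0 : 0 < 1 - opt_coord i by rewrite subr_gt0.
have c_gt0 : 0 < c i by apply: lt_trans (c_gt1 i).
have es_le : (e * s) ^+ 2 <= s ^+ 2 by rewrite exprMn ler_piMl ?sqr_ge0.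
have -> : row_norm i (opt_coord i +i* (e * s)) =
    normc ((1 - opt_coord i) +i* - (e * s))
      + c i * normc (opt_coord i +i* (e * s)).
  by rewrite /row_norm; congr (normc _ + _); simpc.
have := normc_le_quadratic (- (e * s)) w_gt0; rewrite sqrrN.
have := ler_wpM2l (ltW c_gt0) (normc_le_quadratic (e * s) v_gt0).
rewrite -(opt_row_eq i).
have le1 : (e * s) ^+ 2 / (1 - opt_coord i) <= s ^+ 2 / (1 - opt_coord i).
  by rewrite ler_wpM2r // invr_ge0 ltW.
have le2 : c i * ((e * s) ^+ 2 / opt_coord i) <= c i * (s ^+ 2 / opt_coord i).
  by rewrite ler_wpM2l ?(ltW c_gt0) // ler_wpM2r // invr_ge0 ltW.
lra.
Qed.

(* With [b = 1 / (c - 1)], the bound [M >= 1 - Re z + c |z|] scaled by [b]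
   reads [b M >= b + Re z + b c (|z| - Re z)], and [b c = 1 + b >= 1]. *)
Lemma weighted_row_bound i z M : row_norm i z <= M ->
  (c i - 1)^-1 + normc z <= (c i - 1)^-1 * M.
Proof.
move=> row_le; set b := (c i - 1)^-1; have b_gt0 : 0 < b := weight_gt0 i.
have c1 : b * c i = 1 + b.
  by rewrite /b; field; rewrite gt_eqF // subr_gt0.
have Re_le := Re_le_normc z.
have Re1_le : 1 - complex.Re z <= normc (1 - z).
  by apply: le_trans (Re_le_normc (1 - z)); case: (z).
have : b * (1 - complex.Re z + c i * normc z) <= b * M.
  rewrite ler_pM2l //; apply: le_trans row_le; rewrite /row_norm; lra.
rewrite mulrDr mulrA c1; nra.
Qed.

Lemma row_norm_quadratic_growth (w : 'I_n -> R[i]) (M : R) :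
  \sum_i w i = 1 -> (forall i, row_norm i (w i) <= M) ->
  1 + weight_sum^-1 <= M /\
  forall i, normc (w i - (opt_coord i)%:C) ^+ 2 <=
    (weight_sum ^+ 2 + 2 * weight_sum) * (M ^+ 2 - (1 + weight_sum^-1) ^+ 2).
Proof.
move=> sum_w row_le.
have S_gt0 := weight_sum_gt0; set S := weight_sum in S_gt0 *.
pose eps := M - (1 + S^-1).
have sum_Re : \sum_i complex.Re (w i) = 1.
  have : complex.Re (\sum_i w i) = 1 by rewrite sum_w.
  by rewrite (big_morph (@complex.Re R) (id1 := 0) (op1 := +%R)) // => -[? ?] [].
have SM : S * M = S + 1 + S * eps by rewrite /eps; field; rewrite gt_eqF.
(* Summing [weighted_row_bound] over all rows leaves [S * eps] as a bound for the total of the gaps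
   [|w_j| - Re w_j]; these are nonnegative, so it bounds each of them. *)
have gap_le i : normc (w i) - complex.Re (w i) <= S * eps.
  have : \sum_j ((c j - 1)^-1 + complex.Re (w j)
                 + (normc (w j) - complex.Re (w j))) <= S * M.
    rewrite mulr_suml ler_sum // => j _.
    by have := weighted_row_bound (row_le j); lra.
  rewrite !big_split /= -/S sum_Re SM lerD2l; apply: le_trans.
  rewrite -big_split /= (bigD1 i) //= lerDl sumr_ge0 // => j _.
  by rewrite subr_ge0 Re_le_normc.
have eps_ge0 : 0 <= eps.
  have := gap_le (Ordinal n_gt0); rewrite -(pmulr_rge0 _ S_gt0).
  by apply: le_trans; rewrite subr_ge0 Re_le_normc.
have opt_weight j : opt_coord j = (c j - 1)^-1 * S^-1 by [].
have dRe_le j : complex.Re (w j) - opt_coord j <= (c j - 1)^-1 * eps.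
  have := weighted_row_bound (row_le j); have := Re_le_normc (w j).
  by rewrite opt_weight /eps; lra.
split=> [|i]; first by move: eps_ge0; rewrite subr_ge0.
have S_eps_ge0 : 0 <= S * eps by rewrite mulr_ge0 // ltW.
have dRe_abs : `|complex.Re (w i) - opt_coord i| <= S * eps.
  rewrite ler_norml; apply/andP; split; last first.
    by apply: le_trans (dRe_le i) _; rewrite ler_wpM2r ?weight_le_sum.
  (* The deviations sum to zero, so the upper bounds on all the others bound this one from below. *)
  have : \sum_j (complex.Re (w j) - opt_coord j) = 0.
    by rewrite sumrB sum_Re sum_opt_coord subrr.
  rewrite (bigD1 i) //= => /eqP; rewrite addr_eq0 => /eqP ->; rewrite lerN2.
  apply: le_trans (ler_sum _ (fun j _ => dRe_le j)) _.
  rewrite -mulr_suml ler_wpM2r // /S /weight_sum [leRHS](bigD1 i) //= lerDr.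
  exact/ltW/weight_gt0.
have norm_le : normc (w i) <= M.
  have := row_le i; rewrite /row_norm.
  have := normc_ge0 (1 - w i); have := normc_ge0 (w i); have := c_gt1 i; nra.
have m_gt1 : 1 < 1 + S^-1 by rewrite ltrDl invr_gt0.
have -> : normc (w i - (opt_coord i)%:C) ^+ 2 =
    (complex.Re (w i) - opt_coord i) ^+ 2 + complex.Im (w i) ^+ 2.
  by rewrite normc_sqr; case: (w i) => x y /=; rewrite oppr0 addr0.
have Re2_le : (complex.Re (w i) - opt_coord i) ^+ 2 <= (S * eps) ^+ 2.
  by rewrite -[leLHS]real_normK ?num_real // ler_pXn2r ?nnegrE.
have Im2_le : complex.Im (w i) ^+ 2 <= S * eps * (2 * M).
  have -> : complex.Im (w i) ^+ 2 =
      (normc (w i) - complex.Re (w i)) * (normc (w i) + complex.Re (w i)).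
    by have := normc_sqr (w i); lra.
  have Re_le := Re_le_normc (w i).
  apply: (@le_trans _ _ ((normc (w i) - complex.Re (w i)) * (2 * M))).
    by rewrite ler_wpM2l ?subr_ge0 //; lra.
  rewrite ler_wpM2r ?gap_le //; have := normc_ge0 (w i); lra.
(* With [m = 1 + S^-1], the real part uses [eps <= M + m] and the imaginary part [M <= M + m]; they
   contribute the terms [S^2] and [2 S] of the constant. *)
have -> : M ^+ 2 - (1 + S^-1) ^+ 2 = eps * (M + (1 + S^-1)).
  by rewrite /eps; ring.
apply: le_trans (lerD Re2_le Im2_le) _.
rewrite [leRHS]mulrDl; apply: lerD.
  rewrite exprMn ler_wpM2l ?sqr_ge0 // expr2 ler_wpM2l // /eps; lra.
have -> : S * eps * (2 * M) = 2 * S * (eps * M) by ring.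
rewrite ler_wpM2l ?mulr_ge0 ?(ltW S_gt0) // ler_wpM2l //; lra.
Qed.

End RowBounds.

(** * Projections onto the hyperplane and their row sums *)

Section HyperplaneProjections.
Variables (R : realType) (n : nat) (f : 'rV[R[i]]_n).
Hypothesis f_l1 : l1_norm f = 1.
Hypothesis f_lt : forall j : 'I_n, 0 < normc (f 0 j) < 2^-1.

(* The projections onto [ker f] are [x |-> x - f(x) u] with [f(u) = 1]; they are
   parametrised here by [w i = f_i u_i], so that the constraint is [\sum w = 1]. *)
Definition proj_mx (w : 'I_n -> R[i]) : 'M[R[i]]_n :=
  \matrix_(i, j) ((i == j)%:R - w i / f 0 i * f 0 j).

Definition proj (w : 'I_n -> R[i]) : 'End('cV[R[i]]_n) :=
  linfun (mulmx (proj_mx w) : 'cV[R[i]]_n -> 'cV[R[i]]_n).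

(** Since the moduli of [f] sum to 1, this is the ratio of the sum of the other [|f_j|] to [|f_i|];
    the condition [|f_i| < 1/2] says that it exceeds 1. *)
Definition row_weight (i : 'I_n) : R := (normc (f 0 i))^-1 - 1.

Lemma f_neq0 i : f 0 i != 0.
Proof.
apply/eqP => fi0; have /andP[] := f_lt i.
by rewrite fi0 normc0 ltxx.
Qed.

Lemma row_weight_gt1 i : 1 < row_weight i.
Proof.
have /andP[f_gt0 f_lt2] := f_lt i.
have : 2 < (normc (f 0 i))^-1 by rewrite -[2]invrK ltf_pV2 ?posrE ?invr_gt0.
rewrite /row_weight; lra.
Qed.

Lemma dim_gt0 : (0 < n)%N.
Proof.
rewrite lt0n; apply/eqP => n0; have := f_l1.
rewrite /l1_norm big1 => [/eqP|[j ltj] _]; first by rewrite eq_sym oner_eq0.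
by exfalso; rewrite n0 in ltj.
Qed.

(** With a single index the l1 norm would be [|f_i| < 1/2], not 1. *)
Lemma exists_other i : exists j : 'I_n, j != i.
Proof.
apply/existsP; apply: contraT; rewrite negb_exists => /forallP all_i.
have := f_l1; rewrite /l1_norm (bigD1 i) //= big1 => [|j ji]; last first.
  by have := all_i j; rewrite ji.
by have /andP[_] := f_lt i; lra.
Qed.

Lemma projE w x : proj w x = proj_mx w *m x.
Proof. by rewrite lfunE. Qed.

Lemma proj_coordE w x i :
  proj w x i 0 = x i 0 - w i / f 0 i * \sum_j f 0 j * x j 0.
Proof.
rewrite projE mxE mulr_sumr.
under eq_bigr => j _ do rewrite mxE mulrBl.
rewrite sumrB (bigD1 i) //= eqxx mul1r big1 ?addr0 => [|j ji]; last first.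
  by rewrite eq_sym (negPf ji) mul0r.
by congr (_ - _); apply: eq_bigr => j _; rewrite mulrA.
Qed.

Lemma proj_is_projection w : \sum_i w i = 1 ->
  is_projection (hyperplane f) (proj w).
Proof.
move=> sum_w; split=> [x|y].
  rewrite mem_hyperplane; under eq_bigr => i _ do rewrite proj_coordE mulrBr.
  rewrite sumrB subr_eq0; apply/eqP.
  set s := \sum_j _; rewrite -[LHS]mul1r -sum_w mulr_suml.
  by apply: eq_bigr => i _; field; rewrite f_neq0.
rewrite mem_hyperplane => /eqP y0; apply/colP => i.
by rewrite proj_coordE y0 mulr0 subr0.
Qed.

(** For any [v] with [phi v = 1], the vector [x - phi x *: v] lies in the kernel and is fixed by
    [Q]. Hence [Q x = x - phi x *: u] with [u = v - Q v], and [phi u = 1] because [Q v] is in the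
    kernel. *)
Lemma projection_is_proj (Q : 'End('cV[R[i]]_n)) :
  is_projection (hyperplane f) Q -> exists2 w, \sum_i w i = 1 & Q = proj w.
Proof.
move=> [Q_in Q_id].
pose phi (x : 'cV[R[i]]_n) := \sum_j f 0 j * x j 0.
have phiZ a (x y : 'cV[R[i]]_n) : phi (x - a *: y) = phi x - a * phi y.
  rewrite /phi mulr_sumr -sumrB; apply: eq_bigr => j _; rewrite !mxE; ring.
pose k := Ordinal dim_gt0.
pose v : 'cV[R[i]]_n := \col_j (if j == k then (f 0 k)^-1 else 0).
have phi_v : phi v = 1.
  rewrite /phi (bigD1 k) //= big1 => [|j jk].
    by rewrite mxE eqxx addr0 divff ?f_neq0.
  by rewrite mxE (negPf jk) mulr0.
have phi_Q x : phi (Q x) = 0 by apply/eqP; rewrite -mem_hyperplane Q_in.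
pose u := v - Q v.
have QE x : Q x = x - phi x *: u.
  have : Q (x - phi x *: v) = x - phi x *: v.
    by apply: Q_id; rewrite mem_hyperplane -/(phi _) phiZ phi_v mulr1 subrr.
  rewrite linearB linearZ /= => /eqP; rewrite subr_eq => /eqP ->.
  by rewrite /u scalerBr opprB addrA addrAC.
exists (fun i => f 0 i * u i 0).
  by rewrite -/(phi u) /u -[Q v]scale1r phiZ phi_v phi_Q mulr0 subr0.
apply/lfunP => x; apply/colP => i.
by rewrite QE proj_coordE !mxE -/(phi x); field; rewrite f_neq0.
Qed.

Lemma sum_row_others i :
  \sum_(j | j != i) normc (f 0 j) = 1 - normc (f 0 i).
Proof. by rewrite -f_l1 /l1_norm [in RHS](bigD1 i) //= addrAC subrr add0r. Qed.

Lemma proj_row_sum w i :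
  \sum_j normc (proj_mx w i j) = row_norm row_weight i (w i).
Proof.
have fi_neq0 : normc (f 0 i) != 0 by have /andP[/gt_eqF ->] := f_lt i.
rewrite (bigD1 i) //= mxE eqxx divfK ?f_neq0 //; congr (_ + _).
transitivity (\sum_(j | j != i) normc (w i / f 0 i) * normc (f 0 j)).
  apply: eq_bigr => j ji.
  by rewrite mxE eq_sym (negPf ji) sub0r normcN normcM.
rewrite -mulr_sumr sum_row_others normcM normcV /row_weight.
by field.
Qed.

(** The identity parts cancel, leaving a rank-one matrix whose rows are multiples of [f], of l1 norm
    1. *)
Lemma projB_row_sum w v i :
  \sum_j normc ((proj_mx w - proj_mx v) i j) =
    normc (w i - v i) / normc (f 0 i).
Proof.
transitivity (\sum_j normc ((v i - w i) / f 0 i) * normc (f 0 j)).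
  apply: eq_bigr => j _; rewrite -normcM; congr normc; rewrite !mxE; ring.
rewrite -mulr_sumr -/(l1_norm f) f_l1 mulr1 normcM normcV.
by rewrite -(normcN (v i - w i)) opprB.
Qed.

Lemma projBE w v x : (proj w - proj v) x = (proj_mx w - proj_mx v) *m x.
Proof. by rewrite add_lfunE opp_lfunE !projE mulmxBl. Qed.

(** * The minimal projection, its uniqueness and the exponent 2 *)

Local Notation opn := (opnorm (@linf_norm R n)).

Definition opt_vec (i : 'I_n) : R[i] := (opt_coord row_weight i)%:C.

Definition min_norm : R := 1 + (weight_sum row_weight)^-1.

Lemma sum_opt_vec : \sum_i opt_vec i = 1.
Proof.
by rewrite -rmorph_sum /= (sum_opt_coord row_weight_gt1 dim_gt0).
Qed.

Lemma min_norm_gt1 : 1 < min_norm.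
Proof. by rewrite ltrDl invr_gt0 (weight_sum_gt0 row_weight_gt1 dim_gt0). Qed.

Lemma proj_quadratic_growth w : \sum_i w i = 1 -> min_norm <= opn (proj w) /\
  forall i, normc (w i - opt_vec i) ^+ 2 <=
    (weight_sum row_weight ^+ 2 + 2 * weight_sum row_weight)
      * (opn (proj w) ^+ 2 - min_norm ^+ 2).
Proof.
move=> sum_w; apply: row_norm_quadratic_growth sum_w _ => //.
- exact: row_weight_gt1.
- exact: dim_gt0.
by move=> i; rewrite -proj_row_sum row_sum_le_opnorm //; apply: projE.
Qed.

Lemma opnorm_proj_opt : opn (proj opt_vec) = min_norm.
Proof.
apply/eqP; rewrite eq_le (proj_quadratic_growth sum_opt_vec).1 andbT.
apply: (opnorm_le_row_sum (projE _)) => [|i].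
  exact/ltW/(lt_trans ltr01 min_norm_gt1).
by rewrite proj_row_sum row_norm_opt ?dim_gt0 //; apply: row_weight_gt1.
Qed.

Lemma rel_proj_const_hyperplane :
  rel_proj_const (@linf_norm R n) (hyperplane f) = min_norm.
Proof.
pose norms := [set opn P | P in is_projection (hyperplane f)]%classic.
have opt_mem : norms min_norm.
  exists (proj opt_vec); last exact: opnorm_proj_opt.
  exact: proj_is_projection sum_opt_vec.
have opt_lb : lbound norms min_norm.
  move=> _ [Q /projection_is_proj[w sum_w ->] <-].
  exact: (proj_quadratic_growth sum_w).1.
apply/eqP; rewrite eq_le; apply/andP; split.
  by apply: ge_inf => //; exists min_norm.
by apply: lb_le_inf => //; exists min_norm.
Qed.

Lemma proj_opt_strongly_unique :
  strongly_unique (@linf_norm R n) 2 (hyperplane f) (proj opt_vec).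
Proof.
split; first exact: proj_is_projection sum_opt_vec.
have S_gt0 := weight_sum_gt0 row_weight_gt1 dim_gt0.
set S := weight_sum row_weight in S_gt0.
pose K := S ^+ 2 + 2 * S; have K_gt0 : 0 < K.
  by rewrite addr_gt0 ?exprn_gt0 ?mulr_gt0.
pose L := \sum_i (normc (f 0 i))^-1.
have f_gt0 i : 0 < (normc (f 0 i))^-1 by rewrite invr_gt0; have /andP[] := f_lt i.
have f_le i : (normc (f 0 i))^-1 <= L.
  by rewrite /L (bigD1 i) //= lerDl sumr_ge0 // => j _; apply: ltW.
have L_gt0 : 0 < L := lt_le_trans (f_gt0 (Ordinal dim_gt0)) (f_le _).
(* Row [i] of the difference has sum [|w_i - v_i| / |f_i|]. Here [L] bounds every [1 / |f_i|] and
   [K] is the constant of quadratic growth, so the squared distance is at most [L^2 K] times the gap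
   of squared norms. *)
exists (L ^+ 2 * K)^-1; first by rewrite invr_gt0 mulr_gt0 ?exprn_gt0.
move=> _ /projection_is_proj[w sum_w ->].
have [M_ge dist_le] := proj_quadratic_growth sum_w.
set M := opn (proj w) in M_ge dist_le *.
have m_gt0 : 0 < min_norm := lt_trans ltr01 min_norm_gt1.
have gap_ge0 : 0 <= M ^+ 2 - min_norm ^+ 2.
  by rewrite subr_ge0 ler_pXn2r ?nnegrE ?(ltW m_gt0) // (le_trans _ M_ge) ?ltW.
pose D := L * Num.sqrt (K * (M ^+ 2 - min_norm ^+ 2)).
have D_ge0 : 0 <= D by rewrite mulr_ge0 ?sqrtr_ge0 ?(ltW L_gt0).
have dist_ge0 : 0 <= opn (proj w - proj opt_vec).
  apply: le_trans (row_sum_le_opnorm (Ordinal dim_gt0) (projBE _ _)).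
  by apply: sumr_ge0 => j _; apply: normc_ge0.
have dist_le_D : opn (proj w - proj opt_vec) <= D.
  apply: (opnorm_le_row_sum (projBE _ _)) => // i.
  rewrite projB_row_sum mulrC ler_pM ?normc_ge0 ?(ltW (f_gt0 i)) ?f_le //.
  by rewrite -[leLHS]ger0_norm ?normc_ge0 // -sqrtr_sqr ler_wsqrtr // dist_le.
have M_ge0 : 0 <= M by apply: le_trans M_ge; apply: ltW.
rewrite opnorm_proj_opt !powR_mulrn ?(ltW m_gt0) //.
rewrite -lerBrDl mulrC ler_pdivrMr ?mulr_gt0 ?exprn_gt0 //.
apply: (@le_trans _ _ (D ^+ 2)); first by rewrite ler_pXn2r ?nnegrE.
rewrite exprMn sqr_sqrtr ?mulr_ge0 ?(ltW K_gt0) //.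
by rewrite mulrA mulrC.
Qed.

(** At the minimal norm the right side of the quadratic growth bound vanishes, forcing every
    [w i = opt_vec i]. *)
Lemma proj_opt_unique Q :
  is_minimal_projection (@linf_norm R n) (hyperplane f) Q -> Q = proj opt_vec.
Proof.
move=> [/projection_is_proj[w sum_w ->]].
rewrite rel_proj_const_hyperplane => norm_w.
have [_ dist_le] := proj_quadratic_growth sum_w.
have w_opt i : w i = opt_vec i.
  apply/eqP; rewrite -subr_eq0; apply/eqP/eq0_normc/eqP.
  have := dist_le i; rewrite norm_w subrr mulr0 => d_le0.
  by rewrite -sqrf_eq0 eq_le d_le0 sqr_ge0.
by apply/lfunP => x; apply/colP => i; rewrite !proj_coordE w_opt.
Qed.

Lemma proj_opt_not_strongly_unique alpha : 1 <= alpha -> alpha < 2 ->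
  ~ strongly_unique (@linf_norm R n) alpha (hyperplane f) (proj opt_vec).
Proof.
move=> a_ge1 a_lt2 [_ [r r_gt0 su]].
pose k := Ordinal dim_gt0; have [l lk] := exists_other k.
(* A direction of zero sum, so that moving [opt_vec] by [s] times [i e] preserves the constraint on
   the sum. *)
pose e (i : 'I_n) : R := (i == k)%:R - (i == l)%:R.
have e_le1 i : e i ^+ 2 <= 1.
  rewrite /e; case: (i == k); case: (i == l); rewrite /= ?subrr ?subr0 ?sub0r;
  by rewrite ?sqrrN ?expr1n ?expr0n.
have sum_e : \sum_i e i = 0.
  have sum_delta h : \sum_i (i == h :> 'I_n)%:R = 1 :> R.
    by rewrite (bigD1 h) //= eqxx big1 ?addr0 // => j /negPf ->.
  by rewrite sumrB !sum_delta subrr.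
pose v := opt_coord row_weight.
have v_lt1 i : v i < 1.
  have [j ji] := exists_other i.
  exact: (opt_coord_lt1 row_weight_gt1 dim_gt0 ji).
have v_gt0 i : 0 < v i := opt_coord_gt0 row_weight_gt1 dim_gt0 i.
pose t i := (1 - v i)^-1 + row_weight i / v i.
have t_ge0 i : 0 <= t i.
  have w_gt0 := lt_trans ltr01 (row_weight_gt1 i).
  apply: addr_ge0; first by rewrite invr_ge0 subr_ge0 ltW.
  by apply: divr_ge0; apply: ltW.
pose C := \sum_i t i.
have C_ge0 : 0 <= C by apply: sumr_ge0 => ? _.
have t_le i : t i <= C by rewrite /C (bigD1 i) //= lerDl sumr_ge0 // => j _.
have fk_gt0 : 0 < (normc (f 0 k))^-1 by rewrite invr_gt0; have /andP[] := f_lt k.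
apply: (powR_no_quadratic_bound (ltW min_norm_gt1) C_ge0 fk_gt0 r_gt0 a_ge1 a_lt2).
move=> s /andP[s_gt0 _].
pose w i : R[i] := v i +i* (e i * s).
have wE i : w i = opt_vec i + (e i)%:C * (0 +i* s).
  by rewrite /w /opt_vec; simpc.
have sum_w : \sum_i w i = 1.
  under eq_bigr => i _ do rewrite wE.
  by rewrite big_split /= sum_opt_vec -mulr_suml -rmorph_sum sum_e mul0r addr0.
have m_ge0 : 0 <= min_norm := ltW (lt_trans ltr01 min_norm_gt1).
have s2_ge0 := sqr_ge0 s.
have alpha_ge0 : 0 <= alpha by lra.
have MC_ge0 : 0 <= min_norm + C * s ^+ 2.
  by apply: addr_ge0 => //; apply: mulr_ge0.
have norm_w : opn (proj w) <= min_norm + C * s ^+ 2.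
  apply: (opnorm_le_row_sum (projE _)) => // i.
  rewrite proj_row_sum.
  apply: le_trans (row_norm_opt_perturb row_weight_gt1 dim_gt0 s
    (v_lt1 i) (e_le1 i)) _.
  by rewrite lerD2l ler_wpM2r ?t_le.
(* Row [k] alone suffices: since [e k = 1], [w k] differs from [opt_vec k] by a number of modulus
   [s]. *)
have dist_w : (normc (f 0 k))^-1 * s <= opn (proj w - proj opt_vec).
  apply: le_trans (row_sum_le_opnorm k (projBE _ _)).
  rewrite projB_row_sum mulrC ler_wpM2r ?(ltW fk_gt0) // wE addrAC subrr add0r.
  rewrite /e eqxx eq_sym (negPf lk) subr0 rmorph1 mul1r.
  by rewrite /= expr0n add0r sqrtr_sqr ler_norm.
have := su (proj w) (proj_is_projection sum_w); rewrite opnorm_proj_opt => su_w.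
have ks_ge0 : 0 <= (normc (f 0 k))^-1 * s by rewrite mulr_ge0 ?ltW.
have norm_ge0 : 0 <= opn (proj w).
  exact: le_trans m_ge0 (proj_quadratic_growth sum_w).1.
have pow_le := ge0_ler_powR alpha_ge0.
apply: (@le_trans _ _ (opn (proj w) `^ alpha)); last by apply: pow_le.
apply: le_trans su_w; rewrite lerD2l ler_pM2l //.
by apply: pow_le => //; rewrite nnegrE (le_trans ks_ge0).
Qed.

End HyperplaneProjections.

Unset Implicit Arguments.

Theorem theorem5p5 (R : realType) (n : nat) (f : 'rV[R[i]]_n)
    (f_l1 : l1_norm f = 1)
    (f_lt : forall j : 'I_n, 0 < normc (f 0 j) < 2^-1) :
  exists P : 'End('cV[R[i]]_n),
    [/\ is_minimal_projection (@linf_norm R n) (hyperplane f) P,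
        (forall Q : 'End('cV[R[i]]_n),
           is_minimal_projection (@linf_norm R n) (hyperplane f) Q -> Q = P),
        strongly_unique (@linf_norm R n) 2 (hyperplane f) P
      & forall alpha : R, 1 <= alpha -> alpha < 2 ->
          ~ strongly_unique (@linf_norm R n) alpha (hyperplane f) P].
Proof.
exists (proj f (opt_vec f)); split.
- split; first exact: proj_is_projection (sum_opt_vec f_l1 f_lt).
  by rewrite opnorm_proj_opt // rel_proj_const_hyperplane.
- exact: proj_opt_unique.
- exact: proj_opt_strongly_unique.
- exact: proj_opt_not_strongly_unique.
Qed.
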